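(* Let $(X,d)$ be a compact metric space containing at least two points and let $f:X\to X$ be a continuous map. If $f$ has weak asymptotic average shadowing, then $f$ has mean ergodic shadowing.
   Context: $\mathbb{N}$ denotes the set of non-negative integers. A set $E\subset\mathbb{N}$ has density zero if $\lim_{n\to\infty}\frac{1}{n}\#(E\cap\{0,1,\dots,n-1\})=0$. A sequence $\{x_i\}_{i\in\mathbb{N}}$ in $X$ is $\epsilon$-shadowed in average by $x\in X$ if $\limsup_{n\to\infty}\frac1n\sum_{i=0}^{n-1}d(f^i(x),x_i)<\epsilon$. Weak asymptotic average shadowing: $\{x_i\}_{i\in\mathbb{N}}$ is an asymptotic average pseudo orbit for $f$ if $\lim_{n\to\infty}\frac1n\sum_{i=0}^{n-1}d(f(x_i),x_{i+1})=0$. The map $f$ has weak asymptotic average shadowing if for every $\epsilon>0$, every asymptotic average pseudo orbit is $\epsilon$-shadowed in average by some point of $X$. Mean ergodic shadowing: $\{x_i\}_{i\in\mathbb{N}}$ is a $\delta$-ergodic pseudo orbit for $f$ if the set $\{i\in\mathbb{N}: d(f(x_i),x_{i+1})\ge\delta\}$ has density zero. The map $f$ has mean ergodic shadowing if for every $\epsilon>0$ there is $\delta>0$ such that every $\delta$-ergodic pseudo orbit is $\epsilon$-shadowed in average by some point of $X$. *)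

(* Defs.v *)
(* A metric space (X, d) is a [metricType R] over a [realType],
   with d = [mdist]. *)
From mathcomp Require Import all_boot all_order all_algebra finmap.
From mathcomp Require Import all_classical all_reals all_analysis.

Set Implicit Arguments.
Unset Strict Implicit.
Unset Printing Implicit Defensive.

Import Order.TTheory GRing.Theory Num.Theory.
Import numFieldNormedType.Exports.

Local Open Scope classical_set_scope.
Local Open Scope ring_scope.

(* At n = 0 the value is 0^-1 * 0 = 0; only the behaviour at infinity of
   [average u] is ever used. *)
Definition average {R : realType} (u : nat -> R) (n : nat) : R :=
  n%:R^-1 * \sum_(0 <= i < n) u i.

(* [`I_n] is the set {0, ..., n-1}; the intersection is finite, so [fset_set]
   does not lose any element. *)
Definition density_zero (R : realType) (E : set nat) : Prop :=
  (n%:R^-1 * (#|` fset_set (E `&` `I_n)|)%:R : R) @[n --> \oo] --> (0 : R).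

Section Shadowing.
Context {R : realType} {X : metricType R}.
Implicit Types (f : X -> X) (x : nat -> X) (e d : R).

(* The limsup is taken in the extended reals, where it always exists. *)
Definition shadowed_in_average f e x (z : X) : Prop :=
  (limn_esup (fun n =>
     (average (fun i => mdist (iter i f z) (x i)) n)%:E) < e%:E)%E.

Definition asymptotic_average_pseudo_orbit f x : Prop :=
  average (fun i => mdist (f (x i)) (x i.+1)) n @[n --> \oo] --> (0 : R).

Definition weak_asymptotic_average_shadowing f : Prop :=
  forall e, 0 < e -> forall x, asymptotic_average_pseudo_orbit f x ->
    exists z : X, shadowed_in_average f e x z.

Definition ergodic_pseudo_orbit f d x : Prop :=
  density_zero R [set i | d <= mdist (f (x i)) (x i.+1)].

Definition mean_ergodic_shadowing f : Prop :=
  forall e, 0 < e -> exists2 d, 0 < d &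
    forall x, ergodic_pseudo_orbit f d x ->
      exists z : X, shadowed_in_average f e x z.

End Shadowing.

(* Main.v *)
Require Import Defs.
From mathcomp Require Import all_boot all_order all_algebra finmap.
From mathcomp Require Import all_classical all_reals all_analysis.
From mathcomp Require Import lra.

(** Suppose that mean ergodic shadowing fails at [e]. Then for every [k] there
    is a [1/(k+1)]-ergodic pseudo orbit [x k] that no point [e]-shadows in
    average. These sequences are spliced into a single sequence [y], which runs
    through an initial segment of [x 0], then one of [x 1], and so on; that of
    [x k] has length [L k] and starts at time [a k]. The lengths [L k] are
    chosen one after the other so that [y] is an asymptotic average pseudo
    orbit that no point [e/4]-shadows in average, which contradicts weak
    asymptotic average shadowing.

    Errors of [y]. Since [X] has finite diameter and the large jumps of [x k]
    have density zero, the sum of its first [n] jumps is at most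
    [2 n / (k+1)] plus a constant that depends only on [k]
    ([ergodic_pseudo_orbit_sum_le]). Making block [k] so long that [a k.+1]
    dwarfs [a k] and the constants of the blocks [k] and [k+1] makes the
    average error of [y] at most [3/(k+1)] at all times in block [k+1]
    ([concatenation_error]).

    No shadowing. For each [z] there are arbitrarily late times at which the
    average distance between the orbit of [z] and [x k] exceeds [e/2]. This is
    an open condition on [z] at each fixed time, so compactness bounds the time
    needed: for every [M] there is [N] such that each [z] has a bad time
    between [M] and [N] ([uniform_shadowing_failure]). With [M = a k] and
    [L k >= N], apply this to the point that the orbit of [z] has reached at
    time [a k]: its bad time [n] lies within block [k] and [n >= a k], so the
    discarded past [0, ..., a k - 1] is at most half of the averaging window,
    and the average distance between the orbit of [z] and [y] at time [a k + n]
    is at least [e/4]. *)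

Set Implicit Arguments.
Unset Strict Implicit.
Unset Printing Implicit Defensive.

Import Order.TTheory GRing.Theory Num.Theory.
Import numFieldNormedType.Exports.

Local Open Scope classical_set_scope.
Local Open Scope ring_scope.

(** * Averages and upper limits *)

Lemma big_nat_shift (R : realType) (u : nat -> R) a n :
  \sum_(0 <= i < a + n) u i =
  \sum_(0 <= i < a) u i + \sum_(0 <= j < n) u (a + j)%N.
Proof.
rewrite (big_cat_nat (leq0n a) (leq_addr n a))/=; congr (_ + _).
rewrite -[X in \sum_(X <= _ < _) _]add0n big_addn addKn.
by apply: eq_bigr => i _; rewrite addnC.
Qed.

Lemma sum_le_linear (R : realType) (u : nat -> R) c n :
  (forall i, (i < n)%N -> u i <= c) -> \sum_(0 <= i < n) u i <= c * n%:R.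
Proof.
move=> uc; rewrite mulr_natr -[X in _ *+ X]subn0 -sumr_const_nat.
by rewrite big_nat [leRHS]big_nat; apply: ler_sum => i /andP[_]; exact: uc.
Qed.

Lemma sum_ge_of_lt_average (R : realType) (u : nat -> R) c n :
  c < average u n -> c * n%:R <= \sum_(0 <= i < n) u i.
Proof.
rewrite /average; case: n => [|n] cu; first by rewrite mulr0 big_geq.
by rewrite -ler_pdivlMr// mulrC ltW.
Qed.

Lemma average_le (R : realType) (u : nat -> R) c n :
  0 <= c -> \sum_(0 <= i < n) u i <= c * n%:R -> average u n <= c.
Proof.
rewrite /average; case: n => [|n] c0 uc; first by rewrite invr0 mul0r.
by rewrite mulrC ler_pdivrMr.
Qed.

(** An upper limit is an infimum, over the sets of the filter, of suprema over
    these sets: this turns it into an eventual inequality. *)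
Lemma near_lt_of_limn_esup_lt (R : realType) (u : nat -> R) c :
  (limn_esup (fun n => (u n)%:E) < c%:E)%E -> \forall n \near \oo, u n < c.
Proof.
move=> /ereal_inf_lt[_ [V Voo <-] supVc]; near=> n.
rewrite -lte_fin (le_lt_trans _ supVc)//; apply: ereal_sup_ubound.
by exists n => //; near: n.
Unshelve. all: by end_near. Qed.

Lemma limn_esup_le_of_near_le (R : realType) (u : nat -> R) c :
  (\forall n \near \oo, u n <= c) -> (limn_esup (fun n => (u n)%:E) <= c%:E)%E.
Proof.
move=> uc; apply: (@le_trans _ _
    (ereal_sup ((fun n => (u n)%:E) @` [set n | u n <= c]))).
  by apply: ereal_inf_lbound; exists [set n | u n <= c].
by apply: ge_ereal_sup => _ [n /= unc <-]; rewrite lee_fin.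
Qed.

Lemma card_fset_set_II (R : realType) (E : set nat) n :
  (#|` fset_set (E `&` `I_n)|)%:R = \sum_(0 <= i < n) \1_E i :> R.
Proof.
have fin m : finite_set (E `&` `I_m) by exact: finite_setIr.
elim: n => [|n IHn].
  by rewrite II0 setI0 fset_set0 cardfs0 big_geq.
rewrite big_nat_recr//= -IHn IIS setIUr indicE.
have [nE|nE] := boolP (n \in E).
  rewrite (_ : E `&` [set n] = [set n]); last first.
    by apply/seteqP; split => i /= => [[]//|->]; split => //; rewrite -in_setE.
  rewrite setUC fset_setU1// cardfsU1 in_fset_set// natrD addrC.
  rewrite (_ : (n \in E `&` `I_n) = false)//; apply/negbTE/negP.
  by rewrite in_setE => -[_ /=]; rewrite ltnn.
rewrite (_ : E `&` [set n] = set0) ?setU0 ?addr0//.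
by apply/seteqP; split => // i [/= iE ni]; move: nE; rewrite -ni notin_setE.
Qed.

(** * Pseudo orbits in a compact metric space *)

Section metric.
Context {R : realType} {X : metricType R}.
Implicit Types (f : X -> X) (x : nat -> X).

Lemma continuous_mdistl (y : X) : continuous (fun z => mdist z y).
Proof.
move=> z; apply/cvgrPdist_le => e e0.
have ze := nbhsx_ballx z e e0; rewrite ballEmdist in ze.
near=> t; have zt : mdist z t <= e by apply: ltW; near: t.
have := metric_triangle z t y; have := metric_triangle t z y.
by rewrite (metric_sym t z) ler_norml => *; apply/andP; split; lra.
Unshelve. all: by end_near. Qed.

Lemma compact_mdist_bounded : compact [set: X] ->
  exists D : R, forall x y : X, mdist x y <= D.
Proof.
move=> cX; have [[x0]|noX] := pselect (inhabited X); last first.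
  by exists 0 => x; case: noX.
have [||_ [M MX]] := @compact_has_sup R ((fun z => mdist z x0) @` setT).
- by exists (mdist x0 x0), x0.
- apply: continuous_compact cX; apply: continuous_subspaceT.
  exact: continuous_mdistl.
have {}MX z : mdist z x0 <= M by apply: MX; exists z.
exists (M + M) => x y.
rewrite (le_trans (metric_triangle x x0 y))//.
by rewrite lerD// metric_sym.
Qed.

Lemma continuous_average_orbit f x n : continuous f ->
  continuous (fun z => average (fun i => mdist (iter i f z) (x i)) n).
Proof.
move=> cf; have cif i : continuous (iter i f).
  elim: i => [|i IHi] z /=; first exact: cvg_id.
  by apply: (@continuous_comp _ _ _ (iter i f) f); [exact: IHi|exact: cf].
move=> z; rewrite /continuous_at /average; apply: cvgM; first exact: cvg_cst.
elim: n => [|n IHn].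
  by under eq_fun do rewrite big_geq//; rewrite big_geq//; exact: cvg_cst.
under eq_fun do rewrite big_nat_recr//=; rewrite big_nat_recr//=.
apply: cvgD => //.
apply: (@continuous_comp _ _ _ (iter n f) (fun z => mdist z (x n))).
  exact: cif.
exact: continuous_mdistl.
Qed.

(** Failure of shadowing gives each point [z] a bad time beyond [M]. The same
    time is bad for all points near [z], because averages along the orbit up to
    a fixed time are continuous; compactness then bounds the bad times. *)
Lemma uniform_shadowing_failure f e c x : compact [set: X] -> continuous f ->
  c < e -> (forall z, ~ shadowed_in_average f e x z) ->
  forall M, \forall N \near \oo, forall z, exists2 n, (M <= n <= N)%N &
    c < average (fun i => mdist (iter i f z) (x i)) n.
Proof.
move=> /compact_near_coveringP cX cf ce noshadow M.
pose P (N : nat) (z : X) := exists2 n, (M <= n <= N)%N &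
    c < average (fun i => mdist (iter i f z) (x i)) n.
suff : \forall N \near \oo, [set: X] `<=` P N.
  by apply: filterS => N XN z; exact: XN.
apply: cX => z _.
have [n Mn cn] : exists2 n, (M <= n)%N &
    c < average (fun i => mdist (iter i f z) (x i)) n.
  apply: contrapT => small; apply: (noshadow z).
  apply: (@le_lt_trans _ _ c%:E); last by rewrite lte_fin.
  apply: limn_esup_le_of_near_le; exists M => // n /= Mn.
  by rewrite leNgt; apply/negP => cn; apply: small; exists n.
have cvgn := @continuous_average_orbit f x n cf z.
exists ([set z' | c < average (fun i => mdist (iter i f z') (x i)) n],
  [set N | (n <= N)%N]).
  split; last by exists n.
  exact: (cvgr_gt _ cvgn).
by move=> [z' N] /= [cz' nN]; exists n => //; rewrite Mn.
Qed.

(** A jump is at most [d] outside a set of density zero, and at most the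
    diameter [D] on it. Beyond some time [N] the exceptional jumps contribute
    at most [d * n]; before time [N] the whole sum is at most [C = D * N]. *)
Lemma ergodic_pseudo_orbit_sum_le f d x (D : R) :
  (forall y z : X, mdist y z <= D) -> 0 < d -> ergodic_pseudo_orbit f d x ->
  exists2 C, 0 <= C & forall n,
    \sum_(0 <= i < n) mdist (f (x i)) (x i.+1) <= 2 * d * n%:R + C.
Proof.
move=> diam d0 dx.
have D0 : 0 <= D := le_trans (mdist_ge0 _ _) (diam (x 0%N) (x 0%N)).
pose E := [set i | d <= mdist (f (x i)) (x i.+1)].
(* [D + 1] rather than [D], since the diameter may vanish. *)
have dD : 0 < d / (D + 1) by rewrite divr_gt0// ltr_wpDl.
have [N _ HN] : \forall n \near \oo, average (\1_E : nat -> R) n < d / (D + 1).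
  have /cvgrPdist_lt/(_ _ dD) := dx; apply: filterS => n.
  rewrite card_fset_set_II sub0r normrN -/(average _ _).
  exact: le_lt_trans (ler_norm _).
exists (D * N%:R) => [|n]; first by rewrite mulr_ge0.
have [nN|Nn] := ltnP n N.
  have uD : forall i, (i < n)%N -> mdist (f (x i)) (x i.+1) <= D by [].
  rewrite (le_trans (sum_le_linear uD))//.
  apply: (@le_trans _ _ (D * N%:R)); last by rewrite lerDr !mulr_ge0// ltW.
  by rewrite ler_wpM2l// ler_nat ltnW.
have HE : (D + 1) * \sum_(0 <= i < n) \1_E i <= d * n%:R.
  have n1 : average (\1_E : nat -> R) n < d / (D + 1) by exact: HN.
  case: n n1 {Nn} => [|n] n1; first by rewrite big_geq// !mulr0.
  move: n1; rewrite /average mulrC ltr_pdivrMr// => /ltW.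
  by rewrite mulrAC ler_pdivlMr 1?mulrC// ltr_wpDl.
have E0 : 0 <= \sum_(0 <= i < n) \1_E i :> R.
  by apply: sumr_ge0 => i _; rewrite indicE.
apply: (@le_trans _ _ (d * n%:R + D * \sum_(0 <= i < n) \1_E i)); last first.
  have : 0 <= D * N%:R by rewrite mulr_ge0.
  move: HE; rewrite mulrDl mul1r -mulrA; lra.
rewrite -lerBlDr mulr_sumr -sumrB; apply: sum_le_linear => i _.
rewrite lerBlDr indicE; have [iE|iE] := boolP (i \in E).
  by rewrite mulr1 (le_trans (diam _ _))// lerDr ltW.
rewrite mulr0 addr0 ltW// ltNge; apply/negP => iE'.
by move/negP: iE; apply; rewrite in_setE.
Qed.

End metric.

(** * Splicing sequences along blocks *)

(** Each block must be long compared with everything that precedes it, which is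
    why its length [L] is given the time at which it starts. *)
Fixpoint block_start (L : nat -> nat -> nat) k : nat :=
  if k is k'.+1 then (block_start L k' + L k' (block_start L k'))%N else 0%N.

Section blocks.
Variable a : nat -> nat.
Hypotheses (a0 : a 0%N = 0%N) (aS : forall k, (a k < a k.+1)%N).

Lemma increasing_leq : {homo a : k l / (k <= l)%N}.
Proof.
by apply: homo_leq => // [? ? ?|k]; [exact: leq_trans|exact: ltnW].
Qed.

Lemma increasing_ge_id k : (k <= a k)%N.
Proof. by elim: k => // k IHk; exact: leq_ltn_trans IHk (aS k). Qed.

Lemma block_exists i : exists k, (a k <= i < a k.+1)%N.
Proof.
elim: i => [|i [k /andP[ki ik]]]; first exists 0%N.
  by rewrite {1}a0 (leq_ltn_trans _ (aS 0)).
have [ik1|ki1] := ltnP i.+1 (a k.+1); first by exists k; rewrite ik1 leqW.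
by exists k.+1; rewrite ki1 (leq_ltn_trans ik)//.
Qed.

Lemma block_unique k l i :
  (a k <= i < a k.+1)%N -> (a l <= i < a l.+1)%N -> k = l.
Proof.
move=> /andP[ki ik] /andP[li il]; apply/eqP; rewrite eqn_leq.
apply/andP; split; rewrite leqNgt; apply/negP => /increasing_leq h.
  by have := leq_trans (leq_trans il h) ki; rewrite ltnn.
by have := leq_trans (leq_trans ik h) li; rewrite ltnn.
Qed.

Lemma concatenation_exists (T : Type) (x : nat -> nat -> T) :
  exists y : nat -> T, forall k j, (a k + j < a k.+1)%N -> y (a k + j)%N = x k j.
Proof.
have [b bP] := choice block_exists.
exists (fun i => x (b i) (i - a (b i))%N) => k j kj.
rewrite -(@block_unique k (b (a k + j)%N) (a k + j)%N) ?bP ?addKn//.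
by rewrite leq_addr.
Qed.

End blocks.

(** * The error of the concatenation *)

Section concatenation.
Context {R : realType} {X : metricType R}.
Variables (f : X -> X) (D : R) (B : nat -> R) (x : nat -> nat -> X).
Variables (a : nat -> nat) (y : nat -> X).
Hypothesis diam : forall z w : X, mdist z w <= D.
Hypothesis B_ge : forall k, D <= B k.
Hypothesis x_error : forall k n,
  \sum_(0 <= i < n) mdist (f (x k i)) (x k i.+1) + D
    <= 2 * k.+1%:R^-1 * n%:R + B k.
Hypotheses (a0 : a 0%N = 0%N) (aS : forall k, (a k < a k.+1)%N).
Hypothesis a_large :
  forall k, k.+1%:R * (D * (a k)%:R + B k + B k.+1) <= (a k.+1)%:R.
Hypothesis y_block : forall k j, (a k + j < a k.+1)%N -> y (a k + j)%N = x k j.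

Let S n := \sum_(0 <= i < n) mdist (f (y i)) (y i.+1).

(** The transition to the next block is a jump of size at most [D], which is
    why [D] is included in the constant [B k] of block [k]. *)
Lemma concatenation_block_error k n : (a k + n <= a k.+1)%N ->
  S (a k + n) <= S (a k) + (2 * k.+1%:R^-1 * n%:R + B k).
Proof.
move=> kn; rewrite /S big_nat_shift lerD2l; case: n kn => [|n] kn.
  by rewrite big_geq// mulr0 add0r (le_trans _ (B_ge k))//
     (le_trans (mdist_ge0 _ _) (diam (y 0%N) (y 0%N))).
rewrite big_nat_recr//=; apply: (@le_trans _ _
    (\sum_(0 <= i < n) mdist (f (x k i)) (x k i.+1) + D)).
  rewrite lerD// big_nat [leRHS]big_nat; apply: ler_sum => j /andP[_ jn].
  have jn' : (a k + j.+1 < a k.+1)%N.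
    by rewrite (leq_trans _ kn)// ltn_add2l ltnS.
  by rewrite -addnS !y_block//; apply: ltn_trans jn'; rewrite ltn_add2l.
rewrite (le_trans (x_error k n))// lerD2r ler_wpM2l// ?ler_nat//.
Qed.

(** The total error up to time [a k] (at most [D * a k]) and the constants of
    blocks [k] and [k+1] add up to at most [a k.+1 / (k+1)] by the choice of
    [a k.+1]; the frequent small jumps within blocks [k] and [k+1] add at most
    [2 n / (k+1)]. *)
Lemma concatenation_error k n : (a k.+1 <= n < a k.+2)%N ->
  S n <= 3 * k.+1%:R^-1 * n%:R.
Proof.
move=> /andP[an]; rewrite -(subnKC an); move: (n - _)%N => m am.
have := @concatenation_block_error k.+1 m (ltnW am).
have := @concatenation_block_error k (a k.+1 - a k).
rewrite subnKC ?(ltnW (aS k))// => /(_ (leqnn _)).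
have SD : S (a k) <= D * (a k)%:R by exact: sum_le_linear.
have := a_large k; rewrite mulrC -ler_pdivlMr//.
rewrite natrD mulrDr -!mulrA [(a k.+1)%:R / _]mulrC.
have : k.+2%:R^-1 * m%:R <= k.+1%:R^-1 * m%:R :> R.
  by rewrite ler_wpM2r// lef_pV2 ?posrE// ler_nat.
have : k.+1%:R^-1 * (a k.+1 - a k)%:R <= k.+1%:R^-1 * (a k.+1)%:R :> R.
  by rewrite ler_wpM2l// ler_nat leq_subr.
have : 0 <= k.+1%:R^-1 * m%:R :> R by rewrite mulr_ge0.
move: SD; move: (S _) (S _) (S _) (k.+1%:R^-1 * _) (k.+1%:R^-1 * _)
  (k.+1%:R^-1 * _) (k.+2%:R^-1 * _) (D * _) (B k) (B k.+1) => *; lra.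
Qed.

Lemma concatenation_asymptotic : asymptotic_average_pseudo_orbit f y.
Proof.
apply/cvgrPdist_le => e e0.
pose K := Num.truncn (3 / e); exists (a K.+1) => // n /= Kn.
have [k /andP[kn nk]] := block_exists a0 aS n.
have Kk : (K.+1 <= k)%N.
  rewrite leqNgt; apply/negP => /(increasing_leq aS) h.
  by have := leq_trans nk (leq_trans h Kn); rewrite ltnn.
case: k kn nk Kk => // k kn nk Kk.
rewrite sub0r normrN ger0_norm; last first.
  by rewrite /average mulr_ge0// sumr_ge0// => i _; exact: mdist_ge0.
apply: (@le_trans _ _ (3 * k.+1%:R^-1)).
  apply: average_le; first by rewrite mulr_ge0.
  by apply: concatenation_error; rewrite kn.
rewrite ler_pdivrMr// mulrC -ler_pdivrMr// ltW//.
by rewrite (lt_le_trans (truncnS_gt _))// ler_nat.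
Qed.

End concatenation.

(** * Mean ergodic shadowing *)

Theorem proposition3p9 (R : realType) (X : metricType R) (f : X -> X)
    (X_compact : compact [set: X])
    (X_two_points : exists x y : X, x <> y)
    (f_continuous : continuous f) :
  weak_asymptotic_average_shadowing f -> mean_ergodic_shadowing f.
Proof.
move=> shadow e e0; apply: contrapT => noshadow.
have [D diam] := compact_mdist_bounded X_compact.
have /choice[x xP] : forall k : nat, exists x,
    ergodic_pseudo_orbit f k.+1%:R^-1 x /\
    forall z, ~ shadowed_in_average f e x z.
  move=> k; apply: contrapT => noX; apply: noshadow.
  exists k.+1%:R^-1; first by rewrite invr_gt0.
  move=> x dx; apply: contrapT => nz; apply: noX; exists x; split => // z zx.
  by apply: nz; exists z.
have /choice[C CP] : forall k : nat, exists C : R, 0 <= C /\ forall n,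
    \sum_(0 <= i < n) mdist (f (x k i)) (x k i.+1)
      <= 2 * k.+1%:R^-1 * n%:R + C.
  move=> k; have k0 : 0 < k.+1%:R^-1 :> R by rewrite invr_gt0.
  have [C C0 CP] := ergodic_pseudo_orbit_sum_le diam k0 (proj1 (xP k)).
  by exists C.
pose B k := D + C k.
pose c := e / 2; have ce : c < e by rewrite /c; lra.
have /choice[L LP] : forall p : nat * nat, exists l, [/\ (0 < l)%N,
    p.1.+1%:R * (D * p.2%:R + B p.1 + B p.1.+1) <= (p.2 + l)%:R &
    forall z, exists2 n, (p.2 <= n <= l)%N &
      c < average (fun i => mdist (iter i f z) (x p.1 i)) n].
  move=> [k s] /=; set T := k.+1%:R * _.
  have [N _ HN] := uniform_shadowing_failure X_compact f_continuous ce
    (proj2 (xP k)) s.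
  exists (maxn N (Num.truncn T).+1); split; first by rewrite leq_max orbT.
    rewrite ltW// (lt_le_trans (truncnS_gt T))// ler_nat.
    by rewrite (leq_trans (leq_maxr N _))// leq_addl.
  by apply: HN; rewrite /= leq_maxl.
pose a := block_start (fun k s => L (k, s)).
have aE k : a k.+1 = (a k + L (k, a k))%N by [].
have aS k : (a k < a k.+1)%N.
  by rewrite aE -[X in (X < _)%N]addn0 ltn_add2l; have [] := LP (k, a k).
have [y yP] := concatenation_exists (erefl : a 0%N = 0%N) aS x.
have e4 : 0 < e / 4 by lra.
have [|z /near_lt_of_limn_esup_lt[N _ zN]] := shadow _ e4 y.
  apply: (@concatenation_asymptotic _ _ f D B x a y) => //.
  - by move=> k; rewrite lerDl; have [] := CP k.
  - move=> k n; rewrite addrC /B addrCA lerD2l; have [_] := CP k; exact.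
  - by move=> k; rewrite aE; have [] := LP (k, a k).
(* Block [N.+1] rather than [N]: its start [s] is positive, so that the average
   at time [s + n] is a genuine quotient. *)
pose s := a N.+1.
have s0 : (0 < s)%N by exact: leq_ltn_trans (leq0n _) (aS N).
have [_ _ /(_ (iter s f z))[n /= /andP[sn nL]]] := LP (N.+1, s).
move=> /sum_ge_of_lt_average cn.
have : average (fun i => mdist (iter i f z) (y i)) (s + n) < e / 4.
  apply: zN => /=.
  by rewrite (leq_trans (ltnW (increasing_ge_id aS N.+1)))// leq_addr.
apply/negP; rewrite -leNgt /average [leRHS]mulrC ler_pdivlMr; last first.
  by rewrite ltr0n addn_gt0 s0.
rewrite big_nat_shift; apply: (@le_trans _ _ (c * n%:R)).
  (* As [s <= n], the window [s + n] is at most [2 n]. *)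
  have : s%:R <= n%:R :> R by rewrite ler_nat.
  rewrite natrD /c; nra.
rewrite (le_trans cn)//; apply: ler_wpDl.
  by apply: sumr_ge0 => i _; exact: mdist_ge0.
rewrite le_eqVlt; apply/orP; left; apply/eqP.
apply: eq_big_nat => j /andP[_ jn].
rewrite yP; last by rewrite aE ltn_add2l (leq_trans jn).
by rewrite addnC iterD.
Qed.
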